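(* Let $F \in \mathrm{SMU}_{\delta=1}$ and let $T$ be its tree representation. Then: (1) For every clause-set $F'$ equivalent to $D(F)$ there is an injection $i: D(F)\to F'$ with $C \subseteq i(C)$ for all $C\in D(F)$. (2) $D(F)$ is a total mps. (3) $\mathrm{prc}_0(D(F)) = \{C_V : \emptyset \ne V \subseteq \mathrm{lvs}(T)\}$, where for $\emptyset\ne V\subseteq \mathrm{lvs}(T)$ we have $C_V = U_V \cup P_V$ with $U_V\cap P_V=\emptyset$, $U_V = \{u_w : w\in V\}$, and $P_V$ the set of literals $x$ such that $V\cap\mathrm{lvs}(T_x)\neq\emptyset$ and $V\cap\mathrm{lvs}(T_{\overline{x}})=\emptyset$. (4) $\mathrm{hd}(D(F)) = \mathrm{hts}(T)$.
   Context: Clauses are finite sets of literals without complementary pair; clause-sets finite sets of clauses; $\top$ empty clause-set, $\bot$ empty clause. $\mathrm{prc}_0(G)$: prime implicates (inclusion-minimal clauses implied by $G$); clause-sets are equivalent iff they have the same prime implicates. $\mathrm{SMU}_{\delta=1}$: saturated minimally unsatisfiable clause-sets of deficiency $1$ (unsatisfiable, every proper subset satisfiable, adding any literal on a new variable to any clause yields a satisfiable clause-set, and number of clauses minus number of variables equals $1$). Every $F\in\mathrm{SMU}_{\delta=1}$ has a unique tree representation: a full binary tree $T$ whose inner nodes are labelled injectively by variables, where the edge from an inner node labelled $v$ to its left child is labelled $v$ and to its right child $\overline{v}$, such that $F = \{C_w : w \in \mathrm{lvs}(T)\}$, $C_w$ being the set of edge labels on the path from the root to leaf $w$ ($\mathrm{lvs}(T)$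 = set of leaves). For a literal $x$ over $\mathrm{var}(F)$, with $w$ the node labelled $\mathrm{var}(x)$, $T_x$ is the subtree of $w$ reached via the edge labelled $x$. Doping: each $C\in F$ gets a distinct new variable $u_C\notin\mathrm{var}(F)$; $D(F) := \{C\cup\{u_C\}: C\in F\}$; $u_w := u_{C_w}$. For $\emptyset\ne V\subseteq\mathrm{lvs}(T)$, $C_V := \mathrm{pure}(\{C_w\cup\{u_w\} : w\in V\})$, where $\mathrm{pure}(G)$ is the set of literals occurring in $G$ whose complement does not occur in $G$. Mps: $G$ is a minimal premise set for $C$ if $G\models C$ and no proper subset implies $C$; a total mps is a clause-set $G\neq\top$ all of whose nonempty subsets are minimal premise sets (for some clause). Horton–Strahler number $\mathrm{hts}$: $0$ for the one-node tree; for subtrees $T_1,T_2$, $1+\mathrm{hts}(T_1)$ if $\mathrm{hts}(T_1)=\mathrm{hts}(T_2)$, else the maximum. Hardness $\mathrm{hd}(G)$: for unsatisfiable $G$ the minimum $\mathrm{hts}$ of a resolution tree deriving $\bot$ from $G$; $\mathrm{hd}(\top)=0$; for satisfiable $G\neq\top$ the maximum of $\mathrm{hd}(\varphi*G)$ over partial assignments $\varphi$ with $\varphi*G$ unsatisfiable ($\varphi * G$ removes satisfied clauses and falsified literals). *)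

(* Defs.v *)
From mathcomp Require Import all_boot all_order all_algebra finmap.

Set Implicit Arguments.
Unset Strict Implicit.
Unset Printing Implicit Defensive.

Local Open Scope fmap_scope.
Local Open Scope fset_scope.

(** The literal [(v, true)] is the variable [v], and [(v, false)] is its
    complement. *)
Definition literal (VA : choiceType) := (VA * bool)%type.

Definition compl (VA : choiceType) (x : literal VA) : literal VA :=
  (x.1, ~~ x.2).

(** Clauses and clause-sets are carried by raw finite sets; the absence of
    complementary pairs is the separate predicate [is_clause]. *)
Definition clause (VA : choiceType) := {fset literal VA}.
Definition clause_set (VA : choiceType) := {fset clause VA}.

Section ClauseSets.
Variable VA : choiceType.
Implicit Types (x : literal VA) (C E : clause VA) (F G : clause_set VA).

Definition is_clause C : bool := all (fun x => compl x \notin C) C.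
Definition is_clause_set F : bool := all is_clause F.

Definition var_clause C : {fset VA} := [fset x.1 | x in C].
Definition var F : {fset VA} := \bigcup_(C <- F) var_clause C.
Definition lits F : {fset literal VA} := \bigcup_(C <- F) C.

(** The literals over [var F], whether or not they occur in [F]. *)
Definition lits_over F : {fset literal VA} := var F `*` [fset true; false].

Definition pure F : clause VA := [fset x in lits F | compl x \notin lits F].

Definition deficiency F : int := (#|` F|%:Z - #|` var F|%:Z)%R.

Definition passign := {fmap VA -> bool}.
Implicit Type phi : passign.

Definition lit_true phi x : bool := phi.[? x.1] == Some x.2.
Definition lit_false phi x : bool := phi.[? x.1] == Some (~~ x.2).

Definition papply_clause phi C : clause VA :=
  [fset x in C | ~~ lit_false phi x].

Definition papply phi F : clause_set VA :=
  [fset papply_clause phi C | C in F & ~~ has (lit_true phi) C].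

Definition satisfiable F : Prop := exists phi, papply phi F = fset0.

(** For a clause [C] (no complementary pair) this agrees with quantifying over
    total assignments, since what [phi] leaves open in [C] may be falsified. *)
Definition implies F C : Prop :=
  forall phi, papply phi F = fset0 -> papply phi [fset C] = fset0.

Definition prc0 F C : Prop :=
  [/\ is_clause C, implies F C
    & forall E, is_clause E -> E `<` C -> ~ implies F E].

Definition equivalent F G : Prop := forall C, prc0 F C <-> prc0 G C.

Definition minimal_premise_set F C : Prop :=
  implies F C /\ forall G, G `<` F -> ~ implies G C.

Definition total_mps F : Prop :=
  F <> fset0 /\
  forall G, G `<=` F -> G <> fset0 ->
    exists C, is_clause C /\ minimal_premise_set G C.

Definition minimally_unsat F : Prop :=
  ~ satisfiable F /\ forall G, G `<` F -> satisfiable G.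

(** Replacing [C] by [C] extended with a literal whose variable is new for [C];
    that variable may well occur elsewhere in [F]. *)
Definition saturated F : Prop :=
  forall C x, C \in F -> x.1 \notin var_clause C ->
    satisfiable ((x |` C) |` (F `\ C)).

Definition SMU1 F : Prop :=
  [/\ is_clause_set F, minimally_unsat F, saturated F
    & deficiency F = 1%R].

End ClauseSets.

Inductive tree (A : Type) : Type :=
| Leaf
| Node of A & tree A & tree A.
Arguments Leaf {A}.

Fixpoint hts (A : Type) (T : tree A) : nat :=
  match T with
  | Leaf => 0
  | Node _ l r => if hts l == hts r then (hts l).+1 else maxn (hts l) (hts r)
  end.

Fixpoint labels (A : Type) (T : tree A) : seq A :=
  match T with
  | Leaf => [::]
  | Node a l r => a :: labels l ++ labels r
  end.

(** A position is the sequence of directions from the root; [true] goes to the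
    left child, so that direction [b] at a node labelled [v] follows the edge
    labelled by the literal [(v, b)]. *)
Definition position := seq bool.

Fixpoint lvs (A : Type) (T : tree A) : {fset position} :=
  match T with
  | Leaf => [fset [::]]
  | Node _ l r =>
      [fset true :: w | w in lvs l] `|` [fset false :: w | w in lvs r]
  end.

Section TreeRepresentation.
Variable VA : choiceType.
Implicit Types (T : tree VA) (F : clause_set VA) (x : literal VA)
  (u : clause VA -> VA) (V : {fset position}).

Fixpoint path_clause T (w : position) : clause VA :=
  match T, w with
  | Node v l r, b :: w' => (v, b) |` path_clause (if b then l else r) w'
  | _, _ => fset0
  end.

Definition tree_representation T F : Prop :=
  uniq (labels T) /\ F = [fset path_clause T w | w in lvs T].

(** The leaves of the subtree [T_x], as positions in [T]. *)
Fixpoint lvs_sub T x : {fset position} :=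
  match T with
  | Leaf => fset0
  | Node v l r =>
      if v == x.1 then [fset x.2 :: w | w in lvs (if x.2 then l else r)]
      else [fset true :: w | w in lvs_sub l x]
             `|` [fset false :: w | w in lvs_sub r x]
  end.

Definition doping_vars F u : Prop :=
  {in F &, injective u} /\ {in F, forall C, u C \notin var F}.

Definition dope_clause u (C : clause VA) : clause VA := (u C, true) |` C.

Definition dope u F : clause_set VA := [fset dope_clause u C | C in F].

Definition C_of T u V : clause VA :=
  pure [fset dope_clause u (path_clause T w) | w in V].

Definition U_of T u V : clause VA := [fset (u (path_clause T w), true) | w in V].

Definition P_of F T V : clause VA :=
  [fset x in lits_over F |
    (V `&` lvs_sub T x != fset0) && (V `&` lvs_sub T (compl x) == fset0)].

End TreeRepresentation.

Section Hardness.
Variable VA : choiceType.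
Implicit Types (C : clause VA) (F : clause_set VA) (x : literal VA)
  (t : tree VA) (k : nat).

(** [resolution F C t]: there is a resolution tree deriving [C] from [F] whose
    underlying tree is [t], inner nodes carrying the resolution variables.
    Parent clauses clash in exactly one literal, so that resolvents of clauses
    are again free of complementary pairs. *)
Inductive resolution F : clause VA -> tree VA -> Prop :=
| Res_axiom C : C \in F -> resolution F C Leaf
| Res_step x C1 C2 t1 t2 :
    resolution F C1 t1 -> resolution F C2 t2 ->
    C1 `&` [fset compl y | y in C2] = [fset x] ->
    resolution F ((C1 `\ x) `|` (C2 `\ compl x)) (Node x.1 t1 t2).

(** [hd F = k] when [F] is unsatisfiable. *)
Definition hd_unsat F k : Prop :=
  (exists2 t, resolution F fset0 t & hts t = k) /\
  (forall t, resolution F fset0 t -> k <= hts t).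

(** [hd F = k], as a functional relation. *)
Definition hd F k : Prop :=
  [\/ ~ satisfiable F /\ hd_unsat F k,
      F = fset0 /\ k = 0
    | [/\ satisfiable F, F <> fset0,
          exists phi, ~ satisfiable (papply phi F) /\
            hd_unsat (papply phi F) k
        & forall phi k', ~ satisfiable (papply phi F) ->
            hd_unsat (papply phi F) k' -> k' <= k]].

End Hardness.

(* Main.v *)
(** Everything is read off the tree.  If [phi] satisfies the doped clauses of [V]
    but not [C_V], descend from the root, staying above [V] and following edges
    that [phi] does not satisfy: the leaf reached gives a doped clause that [phi]
    does not satisfy.  Conversely, falsifying [C_V] and the path to some [w] in
    [V] satisfies the doped clauses of all other leaves, so the doped clauses of
    [V] form a minimal premise set of [C_V].  Since [pure G <= C] whenever [G] is
    a minimal premise set of [C], the [C_V] are exactly the prime implicates.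
    For the hardness, [T] itself is a resolution refutation of [F].  Restricting a
    resolution tree by an assignment does not increase its Horton-Strahler number;
    this bounds the hardness of every unsatisfiable restriction of [D(F)] from
    above, and yields the lower bound for [F] by induction on [T]. *)
Require Import Defs.
From Stdlib Require Import Classical.
From mathcomp Require Import all_boot all_order all_algebra finmap zify.
Local Open Scope fset_scope.

(* ssrbool also has an [implies]. *)
Local Notation implies := Defs.implies.

(** * Satisfaction, implication and minimal premise sets *)

Section Satisfaction.
Set Implicit Arguments.
Unset Strict Implicit.
Local Open Scope fmap_scope.
Variable VA : choiceType.
Implicit Types (x y : literal VA) (C E : clause VA) (F G H : clause_set VA)
  (phi psi : passign VA).

Lemma complK : involutive (@compl VA).
Proof. by case=> v b; rewrite /compl /= negbK. Qed.

Lemma compl_neq x : compl x != x.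
Proof. by case: x => v [] /=; apply/negP => /eqP. Qed.

Lemma lit_falseE phi x : lit_false phi x = lit_true phi (compl x).
Proof. by []. Qed.

Lemma lit_true_compl phi x : lit_true phi x -> ~~ lit_true phi (compl x).
Proof.
by case: x => v b; rewrite /lit_true /= => /eqP ->; case: b.
Qed.

Lemma is_clauseP C :
  reflect (forall x, x \in C -> compl x \notin C) (is_clause C).
Proof. exact: allP. Qed.

Lemma satP phi F :
  reflect (forall C, C \in F -> has (lit_true phi) C) (papply phi F == fset0).
Proof.
apply: (iffP eqP) => [E C CF|sat].
  apply/negPn/negP => nC.
  have : papply_clause phi C \in papply phi F.
    by apply/imfsetP; exists C => //=; rewrite inE CF.
  by rewrite E.
apply/fsetP => C; rewrite inE; apply/negP => /imfsetP[E /=].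
by rewrite inE => /andP[/sat ->].
Qed.

Lemma sat1P phi C :
  reflect (has (lit_true phi) C) (papply phi [fset C] == fset0).
Proof.
apply: (iffP (satP _ _)) => [|h E]; first by apply; rewrite inE.
by rewrite inE => /eqP ->.
Qed.

Lemma impliesP F C :
  implies F C <-> forall phi, (forall E, E \in F -> has (lit_true phi) E) ->
                    has (lit_true phi) C.
Proof.
split=> h phi.
  by move/satP/eqP/h/eqP/sat1P.
by move=> /eqP/satP/h/sat1P/eqP.
Qed.

Lemma implies_mono G F C : G `<=` F -> implies G C -> implies F C.
Proof.
move=> /fsubsetP GF /impliesP h; apply/impliesP => phi sat; apply: h => E /GF.
exact: sat.
Qed.

Lemma has_sub (a : pred (literal VA)) C E : C `<=` E -> has a C -> has a E.
Proof. by move=> /fsubsetP CE /hasP[x /CE xE ax]; apply/hasP; exists x. Qed.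

Lemma implies_weaken F C E : C `<=` E -> implies F C -> implies F E.
Proof.
move=> CE /impliesP h; apply/impliesP => phi /h.
exact: has_sub.
Qed.

(** For a clause without complementary pair this is the least assignment making all its literals
    false. Countermodels below are mostly given by naming the clause to be falsified. *)
Definition falsifier C : passign VA :=
  [fmap v : [fset x.1 | x in C] => (val v, false) \in C].

Lemma falsifierE C x :
  is_clause C -> lit_true (falsifier C) x = (compl x \in C).
Proof.
case: x => v b /is_clauseP clC; rewrite /lit_true /compl /=.
case: fndP => [vC|nvC]; last first.
  apply/esym/negP => vC; case/negP: nvC; apply/imfsetP.
  by exists (v, ~~ b).
rewrite ffunE /=; case: b => /=.
  by apply/eqP/idP => [[]|->].
have [nC|nC] := boolP ((v, false) \in C).
  by apply/esym/negP => /clC; rewrite /compl /= nC.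
by case/imfsetP: vC nC => -[v' [] /= vC ->]; rewrite vC.
Qed.

Lemma falsifier_unsat C E :
  is_clause C -> E `<=` C -> ~~ has (lit_true (falsifier C)) E.
Proof.
move=> clC /fsubsetP EC; apply/hasPn => x /EC xC; rewrite falsifierE //.
exact: (is_clauseP _ clC).
Qed.

(** Serves twice: for clause-sets it yields minimal premise sets, for clauses it yields prime
    implicates. *)
Lemma minimal_fset (K : choiceType) (P : {fset K} -> Prop) (A : {fset K}) :
  P A -> exists B, [/\ B `<=` A, P B & forall B', B' `<` B -> ~ P B'].
Proof.
have [n] := ubnP #|` A|; elim: n A => // n IH A; rewrite ltnS => An PA.
have [[B [BA PB]]|nB] := classic (exists B, B `<` A /\ P B).
  have [|E [EB PE mE]] := IH B _ PB.
    by apply: leq_trans An; apply: fproper_ltn_card.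
  by exists E; split=> //; apply: fsubset_trans EB (fproper_sub BA).
exists A; split=> // B BA PB; apply: nB; by exists B.
Qed.

Lemma mps_exists F C :
  implies F C -> exists2 G, G `<=` F & minimal_premise_set G C.
Proof.
by move=> /(@minimal_fset _ (fun G : clause_set VA => implies G C))[G [GF GC mG]]; exists G.
Qed.

Lemma prc0_below F C :
  is_clause C -> implies F C -> exists2 E, E `<=` C & prc0 F E.
Proof.
move=> clC FC.
have [//|E [EC [clE FE] mE]] :=
  @minimal_fset _ (fun E : clause VA => is_clause E /\ implies F E) C.
by exists E => //; split=> // E' clE' E'E FE'; apply: (mE _ E'E).
Qed.

Lemma litsP F x : reflect (exists2 C, C \in F & x \in C) (x \in lits F).
Proof.
apply: (iffP (bigfcupP _ _ _ _)) => -[C CF xC]; exists C => //.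
  by rewrite andbT in CF.
by rewrite CF.
Qed.

Lemma pureE F x : (x \in pure F) = (x \in lits F) && (compl x \notin lits F).
Proof. by rewrite !inE. Qed.

Lemma pure_is_clause F : is_clause (pure F).
Proof.
apply/is_clauseP => x; rewrite !pureE => /andP[_ nx].
by rewrite (negbTE nx).
Qed.

(* Making a pure literal true repairs the one premise that may fail. *)
Lemma pure_sub_mps F C : minimal_premise_set F C -> pure F `<=` C.
Proof.
case=> /impliesP FC mF; apply/fsubsetP => x; rewrite pureE.
case/andP=> /litsP[E EF xE] /negP nx.
apply: NNPP => /negP nxC; apply: (mF (F `\ E) (fproperD1 EF)).
apply/impliesP => phi sat.
have setE y : lit_true phi.[x.1 <- x.2] y =
    if y.1 == x.1 then y == x else lit_true phi y.
  rewrite /lit_true fnd_set; case: (y.1 =P x.1) => // e.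
  by case: x y e {xE nx nxC} => v b [w c] /= ->; rewrite xpair_eqE eqxx eq_sym.
have /FC/hasP[y yC] : forall D, D \in F -> has (lit_true phi.[x.1 <- x.2]) D.
  move=> D DF; have [->|nDE] := eqVneq D E.
    by apply/hasP; exists x; rewrite // setE !eqxx.
  have /sat/hasP[y yD py] : D \in F `\ E by rewrite !inE nDE.
  (* The old witness [y] of [D] could be lost only as the complement of [x], which purity keeps out
     of [D]. *)
  apply/hasP; exists y => //; rewrite setE; case: (y.1 =P x.1) => // e.
  apply/negPn/negP => nyx; apply: nx; apply/litsP; exists D => //.
  suff -> : compl x = y by [].
  case: x y nyx e {xE nxC setE py yD} => v b [w c] /= n e; subst w.
  by move: n; rewrite xpair_eqE eqxx /compl /=; case: b c => [] [].
rewrite setE; case: (y.1 =P x.1) => [_ /eqP e|_ py]; first by rewrite -e yC in nxC.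
by apply/hasP; exists y.
Qed.
End Satisfaction.

(** * Leaves and path clauses of a labelled tree *)

Section Leaves.
Set Implicit Arguments.
Unset Strict Implicit.
Variable VA : choiceType.
Implicit Types (x y : literal VA) (T l r : tree VA) (w : position)
  (V : {fset position}) (phi : passign VA).

Lemma mem_imfset_cons b b' w V :
  (b :: w \in [fset b' :: w' | w' in V]) = (b == b') && (w \in V).
Proof.
apply/imfsetP/andP => [[w' /= w'V [-> ->]]|[/eqP-> wV]]; first by rewrite eqxx.
by exists w.
Qed.

Lemma nil_imfset_cons b V : ([::] \in [fset b :: w | w in V]) = false.
Proof. by apply/negP => /imfsetP[]. Qed.

Lemma lvs_cons v l r b w :
  (b :: w \in lvs (Node v l r)) = (w \in lvs (if b then l else r)).
Proof. by rewrite !inE !mem_imfset_cons; case: b; rewrite ?orbF. Qed.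

Lemma lvs_nil v l r : ([::] \in lvs (Node v l r)) = false.
Proof. by rewrite !inE !nil_imfset_cons. Qed.

Lemma mem_path_cons v l r b w x :
  (x \in path_clause (Node v l r) (b :: w)) =
  (x == (v, b)) || (x \in path_clause (if b then l else r) w).
Proof. by rewrite !inE. Qed.

Lemma path_labels T w x : x \in path_clause T w -> x.1 \in labels T.
Proof.
elim: T w => [|v l IHl r IHr] [|b w] //.
rewrite mem_path_cons => /orP[/eqP-> | ]; first by rewrite inE eqxx.
by rewrite inE mem_cat; case: b => [/IHl|/IHr] ->; rewrite ?orbT.
Qed.

Lemma uniq_child v l r : uniq (labels (Node v l r)) ->
  [/\ v \notin labels l, v \notin labels r, uniq (labels l), uniq (labels r)
    & forall a, a \in labels l -> a \notin labels r].
Proof.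
rewrite /= mem_cat negb_or cat_uniq => /andP[/andP[vl vr] /and3P[ul h ur]].
by split=> // a al; apply: contraNN h => ar; apply/hasP; exists a.
Qed.

Lemma path_is_clause T w : uniq (labels T) -> is_clause (path_clause T w).
Proof.
move=> uT; apply/is_clauseP.
elim: T uT w => [|v l IHl r IHr] // /uniq_child[vl vr /IHl{}IHl /IHr{}IHr _].
have nv b w x : x \in path_clause (if b then l else r) w -> x.1 != v.
  by case: b => /path_labels; apply: contraTneq => ->.
case=> [|b w] // x; rewrite !mem_path_cons negb_or.
case/orP=> [/eqP->|xp]; apply/andP; split.
- exact: compl_neq.
- by apply/negP => /nv; rewrite eqxx.
- by apply: contraNneq (nv _ _ _ xp) => /(congr1 fst) /= ->.
- by case: b xp => [/IHl|/IHr].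
Qed.

(** At the node where the two paths part, they follow complementary edges. Thus the path clauses
    form a hitting clause-set. *)
Lemma leaves_clash T w w' : w \in lvs T -> w' \in lvs T -> w != w' ->
  exists2 x, x \in path_clause T w & compl x \in path_clause T w'.
Proof.
elim: T w w' => [|v l IHl r IHr] w w'; first by rewrite !inE => /eqP-> /eqP->.
case: w w' => [|b w] [|b' w']; rewrite ?lvs_nil // !lvs_cons.
have [<-|bb'] := eqVneq b b'.
  rewrite eqseq_cons eqxx /= => wl w'l ne.
  have [x xw xw'] : exists2 x, x \in path_clause (if b then l else r) w &
      compl x \in path_clause (if b then l else r) w'.
    by case: b wl w'l ne => [/IHl|/IHr]; apply.
  by exists x; rewrite mem_path_cons ?xw ?xw' orbT.
move=> _ _ _; exists (v, b); rewrite mem_path_cons ?eqxx //.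
by rewrite /compl /=; case: b b' bb' => [] []; rewrite ?eqxx.
Qed.

(** [lvs_sub] stops at the first node labelled [x.1]; since labels are unique, that variable does
    not reappear further down. This translates the condition defining [P_of] into purity of path
    literals. *)
Lemma mem_lvs_sub T w x : uniq (labels T) -> w \in lvs T ->
  (w \in lvs_sub T x) = (x \in path_clause T w).
Proof.
elim: T w x => [|v l IHl r IHr] w x; first by rewrite !inE.
move=> /uniq_child[vl vr /IHl{}IHl /IHr{}IHr _].
case: w => [|b w]; rewrite ?lvs_nil // lvs_cons mem_path_cons => wl /=.
have [e|ne] := eqVneq v x.1.
  rewrite mem_imfset_cons; case: x e => a c /= <-.
  rewrite xpair_eqE eqxx /= [b == c]eq_sym.
  have -> : ((v, c) \in path_clause (if b then l else r) w) = false.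
    by apply/negP; case: (b) => /path_labels; apply/negP.
  by rewrite orbF; case: eqP => // ->.
have -> : (x == (v, b)) = false by apply: contraNF ne => /eqP->.
rewrite in_fsetU !mem_imfset_cons.
by case: b wl => /= wl; rewrite ?orbF ?IHl ?IHr.
Qed.

(* Descend from the root, leaving a node by an edge that [phi] does not satisfy
   whenever both of its subtrees still contain admissible leaves. *)
Lemma descent T phi (P : pred position) : uniq (labels T) ->
  (exists2 w, w \in lvs T & P w) ->
  exists w, [/\ w \in lvs T, P w &
    forall x, x \in path_clause T w -> lit_true phi x ->
      forall w', w' \in lvs T -> P w' -> compl x \notin path_clause T w'].
Proof.
elim: T P => [|v l IHl r IHr] P uT [w0 w0T Pw0]; first by exists w0.
have [vl vr ul ur lr] := uniq_child uT.
pose T' (b : bool) := if b then l else r.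
pose Q b := exists2 w, w \in lvs (T' b) & P (b :: w).
have IH b : Q b -> exists w, [/\ w \in lvs (T' b), P (b :: w) &
    forall x, x \in path_clause (T' b) w -> lit_true phi x ->
      forall w', w' \in lvs (T' b) -> P (b :: w') ->
        compl x \notin path_clause (T' b) w'].
  by case: b => [/(IHl (fun w => P (true :: w)) ul)
               |/(IHr (fun w => P (false :: w)) ur)].
(* If both sides have admissible leaves, one of the two edges is not satisfied by [phi], and that
   one is taken. *)
have [b Qb nQ] : exists2 b, Q b & lit_true phi (v, b) -> ~ Q (~~ b).
  case: w0 w0T Pw0 => [|b w0]; rewrite ?lvs_nil // lvs_cons => wl Pw.
  have Qb : Q b by exists w0.
  have [Qnb|nQ] := classic (Q (~~ b)); last by exists b.
  have [pb|nb] := boolP (lit_true phi (v, b)); last first.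
    by exists b => // pb; rewrite pb in nb.
  exists (~~ b) => // pnb; have := lit_true_compl pb.
  by rewrite /compl /= pnb.
have [w [wl Pw Hw]] := IH b Qb.
exists (b :: w); split; rewrite ?lvs_cons // => x.
rewrite mem_path_cons => xp px [|b' w']; rewrite ?lvs_nil // lvs_cons => w'l Pw'.
rewrite mem_path_cons negb_or.
case/orP: xp => [/eqP e|xp].
  subst x; have -> : b' = b.
    apply/eqP/negPn/negP => nbb; apply: nQ => //.
    by exists w'; have -> : ~~ b = b' by case: b b' nbb {Qb Hw wl Pw px w'l Pw'} => [] [].
  rewrite compl_neq /=; apply/negP => /path_labels.
  by case: (b); apply/negP.
have nv : compl x != (v, b').
  by apply: contraTneq xp => /(congr1 fst) /= xv; apply/negP;
    case: (b) => /path_labels; rewrite xv; apply/negP.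
(* In the same child the recursive choice applies; in the other child disjointness of the labels
   excludes the complement of [x]. *)
rewrite nv /=; have [e|nbb] := eqVneq b' b.
  by subst b'; apply: (Hw _ xp px).
apply/negP => /path_labels /= h'; have := path_labels xp.
case: b b' nbb h' {Qb nQ Hw wl Pw xp px w'l Pw' nv} => [] [] // _ h1 h2.
  by have := lr _ h2; rewrite h1.
by have := lr _ h1; rewrite h2.
Qed.
End Leaves.

(** * Resolution trees, restriction and Horton-Strahler numbers *)

Section Resolution.
Set Implicit Arguments.
Unset Strict Implicit.
Local Open Scope fmap_scope.
Variable VA : choiceType.
Implicit Types (x y : literal VA) (C E : clause VA) (F G : clause_set VA)
  (T l r t : tree VA) (w : position) (phi psi : passign VA).

Lemma hts_NodeS (v : VA) l r n :
  n <= hts l -> n <= hts r -> n.+1 <= hts (Node v l r).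
Proof. by rewrite /=; case: eqP; lia. Qed.

Lemma hts_Node_ge (v : VA) l r :
  (hts l <= hts (Node v l r)) && (hts r <= hts (Node v l r)).
Proof. by rewrite /=; case: eqP; lia. Qed.

(** The critical case is [hts l = hts r]: then the larger pair either ties too or has a strictly
    larger maximum. *)
Lemma hts_Node_mono (v v' : VA) l r l' r' : hts l <= hts l' -> hts r <= hts r' ->
  hts (Node v l r) <= hts (Node v' l' r').
Proof. by rewrite /=; do 2![case: eqP]; lia. Qed.

Lemma resolution_mono F G C t :
  F `<=` G -> resolution F C t -> resolution G C t.
Proof.
move=> /fsubsetP FG; elim=> [{}C /FG|x C1 C2 t1 t2 _ R1 _ R2 E].
  exact: Res_axiom.
exact: Res_step E.
Qed.

Lemma mem_papply_clause phi C x :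
  (x \in papply_clause phi C) = (x \in C) && ~~ lit_false phi x.
Proof. by rewrite !inE. Qed.

Lemma papplyP phi F E :
  reflect (exists C, [/\ C \in F, ~~ has (lit_true phi) C
                       & E = papply_clause phi C])
          (E \in papply phi F).
Proof.
apply: (iffP (imfsetP _ _ _ _)) => [[C /=]|[C [CF nC ->]]].
  by rewrite inE => /andP[CF nC] ->; exists C.
by exists C => //=; rewrite inE CF.
Qed.

Lemma clashP C1 C2 x : C1 `&` [fset compl y | y in C2] = [fset x] ->
  [/\ x \in C1, compl x \in C2 & forall y, y \in C1 -> compl y \in C2 -> y = x].
Proof.
move/fsetP => E; have mE y : (y \in C1) && (compl y \in C2) = (y == x).
  have := E y; rewrite inE in_fset1 => <-; congr (_ && _).
  apply/idP/imfsetP => [yC|[z /= zC ->]]; last by rewrite complK.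
  by exists (compl y); rewrite ?complK.
have /andP[xC cC] : (x \in C1) && (compl x \in C2) by rewrite mE.
by split=> // y yC cyC; apply/eqP; rewrite -mE yC cyC.
Qed.

Lemma mem_resolvent C1 C2 x y : (y \in (C1 `\ x) `|` (C2 `\ compl x)) =
  ((y != x) && (y \in C1)) || ((y != compl x) && (y \in C2)).
Proof. by rewrite !inE. Qed.

(** Induction on the derivation. If [psi] satisfies one resolution literal, only the premise with
    the other one is kept; if a restricted premise has lost its resolution literal, that premise
    alone suffices; otherwise the step is repeated. Subtrees are only discarded, so the
    Horton-Strahler number cannot grow. *)
Lemma resolution_restrict F C t psi :
  resolution F C t -> ~~ has (lit_true psi) C ->
  exists C' t', [/\ C' `<=` papply_clause psi C, resolution (papply psi F) C' t'
                  & hts t' <= hts t].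
Proof.
elim=> [{}C CF nC|x C1 C2 t1 t2 _ IH1 _ IH2 /clashP[xC1 xC2 only] nR].
  exists (papply_clause psi C), Leaf; split=> //.
  by apply/Res_axiom/papplyP; exists C.
have sR y : ((y != x) && (y \in C1)) || ((y != compl x) && (y \in C2)) ->
    ~~ lit_true psi y.
  by rewrite -mem_resolvent; apply: (hasPn nR).
have [le1 le2] := andP (hts_Node_ge x.1 t1 t2).
have use1 : ~~ lit_true psi x -> exists C' t',
    [/\ C' `<=` papply_clause psi C1, resolution (papply psi F) C' t'
      & hts t' <= hts t1].
  move=> nx; apply: IH1; apply/hasPn => y yC.
  by have [->|yx] := eqVneq y x; last by apply: sR; rewrite yx yC.
have use2 : ~~ lit_true psi (compl x) -> exists C' t',
    [/\ C' `<=` papply_clause psi C2, resolution (papply psi F) C' t'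
      & hts t' <= hts t2].
  move=> nx; apply: IH2; apply/hasPn => y yC.
  by have [->|yx] := eqVneq y (compl x); last by apply: sR; rewrite yx yC orbT.
have keep1 C' t' : C' `<=` papply_clause psi C1 ->
    resolution (papply psi F) C' t' -> hts t' <= hts t1 -> x \notin C' ->
    exists C' t', [/\ C' `<=` papply_clause psi ((C1 `\ x) `|` (C2 `\ compl x)),
      resolution (papply psi F) C' t' & hts t' <= hts (Node x.1 t1 t2)].
  move=> sC' R' h' nx; exists C', t'; split=> //; last exact: leq_trans le1.
  apply/fsubsetP => y yC'; have := fsubsetP sC' _ yC'.
  rewrite !mem_papply_clause mem_resolvent => /andP[-> ->].
  by rewrite !andbT; apply/orP; left; apply: contraNneq nx => <-.
have keep2 C' t' : C' `<=` papply_clause psi C2 ->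
    resolution (papply psi F) C' t' -> hts t' <= hts t2 -> compl x \notin C' ->
    exists C' t', [/\ C' `<=` papply_clause psi ((C1 `\ x) `|` (C2 `\ compl x)),
      resolution (papply psi F) C' t' & hts t' <= hts (Node x.1 t1 t2)].
  move=> sC' R' h' nx; exists C', t'; split=> //; last exact: leq_trans le2.
  apply/fsubsetP => y yC'; have := fsubsetP sC' _ yC'.
  rewrite !mem_papply_clause mem_resolvent => /andP[-> ->].
  by rewrite !andbT; apply/orP; right; apply: contraNneq nx => <-.
have [px|nx] := boolP (lit_true psi x).
  have [C' [t' [sC' R' h']]] := use2 (lit_true_compl px).
  apply: (keep2 _ _ sC' R' h'); apply/negP => /(fsubsetP sC').
  by rewrite mem_papply_clause lit_falseE complK px andbF.
have [C1' [t1' [sC1 R1 h1]]] := use1 nx.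
have [x1|] := boolP (x \in C1'); last exact: keep1 R1 h1.
have /andP[_ ncx] : (x \in C1) && ~~ lit_false psi x.
  by rewrite -mem_papply_clause (fsubsetP sC1).
have [C2' [t2' [sC2 R2 h2]]] := use2 ncx.
have [x2|] := boolP (compl x \in C2'); last exact: keep2 R2 h2.
exists ((C1' `\ x) `|` (C2' `\ compl x)), (Node x.1 t1' t2'); split.
- apply/fsubsetP => y; rewrite mem_papply_clause !mem_resolvent.
  case/orP=> /andP[-> yC].
    by have := fsubsetP sC1 _ yC; rewrite mem_papply_clause => /andP[-> ->].
  have := fsubsetP sC2 _ yC; rewrite mem_papply_clause => /andP[-> ->].
  by rewrite orbT.
- apply: Res_step => //; apply/fsetP => y; rewrite in_fset1 inE.
  apply/andP/eqP => [[yC1 /imfsetP[z /= zC e]]|->]; last first.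
    by split=> //; apply/imfsetP; exists (compl x); rewrite ?complK.
  apply: only.
    by have := fsubsetP sC1 _ yC1; rewrite mem_papply_clause => /andP[].
  by have := fsubsetP sC2 _ zC; rewrite mem_papply_clause e complK => /andP[].
- exact: hts_Node_mono.
Qed.

(** [C] collects the edge labels above the current node, and each inner node resolves on its own
    label. For empty [C] this makes [T] a refutation. *)
Lemma resolution_tree F T C : uniq (labels T) -> is_clause C ->
  (forall x, x \in C -> x.1 \notin labels T) ->
  (forall w, w \in lvs T -> C `|` path_clause T w \in F) -> resolution F C T.
Proof.
elim: T C => [|v l IHl r IHr] C.
  move=> _ _ _ /(_ [::]); rewrite fsetU0 => h; apply: Res_axiom.
  by apply: h; rewrite inE.
move=> uT clC dC CF; have [vl vr ul ur lr] := uniq_child uT.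
have vC b : (v, b) \notin C by apply/negP => /dC; rewrite inE eqxx.
have clC' b : is_clause ((v, b) |` C).
  apply/is_clauseP => x; rewrite !inE negb_or => /orP[/eqP-> | xC].
    by rewrite compl_neq vC.
  rewrite (is_clauseP _ clC _ xC) andbT; apply: contraNneq (vC (~~ b)) => e.
  by rewrite -[x]complK e in xC.
have CF' b w : w \in lvs (if b then l else r) ->
    ((v, b) |` C) `|` path_clause (if b then l else r) w \in F.
  rewrite -(lvs_cons v) => /CF; congr (_ \in F).
  by rewrite [LHS]fsetUCA fsetUA.
have dC' b x : x \in (v, b) |` C -> x.1 \notin labels (if b then l else r).
  rewrite !inE => /orP[/eqP->|/dC]; first by case: b.
  by rewrite inE mem_cat !negb_or; case: b => /and3P[].
have Rl := IHl _ ul (clC' true) (dC' true) (CF' true).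
have Rr := IHr _ ur (clC' false) (dC' false) (CF' false).
(* Resolving the clauses of the two children on [v] gives back [C]. *)
have -> : C = (((v, true) |` C) `\ (v, true))
    `|` (((v, false) |` C) `\ compl (v, true)).
  by rewrite /compl /= !fsetU1K // fsetUid.
apply: Res_step => //; apply/fsetP => y; rewrite in_fset1 inE.
apply/andP/eqP => [[yC /imfsetP[z /= zC e]]|->].
  subst y; move: yC zC; rewrite !inE => /orP[/eqP //|cz] /orP[/eqP e|zC].
    by move: cz; rewrite e /compl /= (negbTE (vC _)).
  by have := is_clauseP _ clC _ zC; rewrite cz.
split; first by rewrite !inE eqxx.
by apply/imfsetP; exists (v, false); rewrite //= !inE eqxx.
Qed.

Definition leaf_clauses T : clause_set VA := [fset path_clause T w | w in lvs T].

(** The value of [v] satisfies all clauses through the other child and deletes [(v, b)] from the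
    rest, which [psi] leaves otherwise untouched. *)
Lemma papply_leaf_clauses v l r b psi : psi.[? v] = Some (~~ b) ->
  (forall a, a \in labels (if b then l else r) -> psi.[? a] = None) ->
  papply psi (leaf_clauses (Node v l r)) `<=`
    leaf_clauses (if b then l else r).
Proof.
move=> pv pn; apply/fsubsetP => E /papplyP[C [/imfsetP[w wT ->] nC ->]].
have {}wT : w \in lvs (Node v l r) := wT.
case: w wT nC => [|b' w]; rewrite ?lvs_nil // lvs_cons => wl nC.
have e : b' = b.
  apply/eqP/negPn/negP => nb; case/hasP: nC; exists (v, b').
    by rewrite mem_path_cons eqxx.
  by rewrite /lit_true pv; case: b b' nb {pv pn wl} => [] [].
subst b'; apply/imfsetP; exists w => //=; apply/fsetP => x.
rewrite mem_papply_clause mem_path_cons /lit_false.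
case: (x =P (v, b)) => [->|_] /=.
  by rewrite pv eqxx /=; apply/esym/negP => /path_labels/pn; rewrite pv.
by have [/path_labels/pn->|] := boolP (x \in path_clause _ w).
Qed.

Lemma refutation_inv F C t : resolution F C t -> C = fset0 ->
  fset0 \in F \/ exists x C1 C2 t1 t2,
    [/\ t = Node x.1 t1 t2, C1 `<=` [fset x], C2 `<=` [fset compl x],
        resolution F C1 t1 & resolution F C2 t2].
Proof.
case=> [{}C CF <-|x C1 C2 t1 t2 R1 R2 _ /fsetP E]; first by left.
right; exists x, C1, C2, t1, t2; split=> //; apply/fsubsetP => y yC;
  rewrite in_fset1; apply/negPn/negP => ny; have := E y;
  by rewrite mem_resolvent ny yC ?orbT.
Qed.

(* Let the last resolution step be on [x].  Some child of the root has no label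
   [x.1] and is what remains under an assignment falsifying [x] (resp. its
   complement); so both premises need at least that child's Horton-Strahler
   number. *)
Lemma hts_refutation T t : uniq (labels T) ->
  resolution (leaf_clauses T) fset0 t -> hts T <= hts t.
Proof.
elim: T t => [|v l IHl r IHr] t // uT R.
have [vl vr ul ur lr] := uniq_child uT.
pose T' (b : bool) := if b then l else r.
have IH b s : resolution (leaf_clauses (T' b)) fset0 s -> hts (T' b) <= hts s.
  by case: b; [apply: IHl | apply: IHr].
have child b x C s : C `<=` [fset x] -> (x.1 = v -> x.2 = b) ->
    x.1 \notin labels (T' b) -> resolution (leaf_clauses (Node v l r)) C s ->
    hts (T' b) <= hts s.
  move=> /fsubsetP Cx xv nx Rs.
  (* Falsifies [x] and selects the child [b]; if [x.1 = v] the second update overrides the first,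
     with the same value because then [x.2 = b]. *)
  pose psi : passign VA := [fmap].[x.1 <- ~~ x.2].[v <- ~~ b].
  have psix : psi.[? x.1] = Some (~~ x.2).
    by rewrite !fnd_set eqxx; case: eqP => // /xv ->.
  have [|C' [t' [/fsubsetP sC' R' h']]] := resolution_restrict (psi := psi) Rs.
    apply/hasPn => y /Cx; rewrite in_fset1 => /eqP ->.
    by rewrite /lit_true psix; case: (x.2).
  have C'0 : C' = fset0.
    apply/fsetP => y; rewrite in_fset0; apply/negP => /sC'.
    rewrite mem_papply_clause => /andP[/Cx]; rewrite in_fset1 => /eqP ->.
    by rewrite /lit_false psix eqxx.
  apply: leq_trans h'; apply: IH; rewrite -C'0; apply: resolution_mono R'.
  apply: papply_leaf_clauses; first by rewrite fnd_set eqxx.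
  move=> a aT; rewrite !fnd_set fnd_fmap0.
  have -> : (a == v) = false.
    by apply: contraTF aT => /eqP->; case: (b).
  by have -> : (a == x.1) = false by apply: contraTF aT => /eqP->.
have vT' b : v \notin labels (T' b) by case: b.
(* For unequal children the maximum is enough, and restricting the whole refutation gives it; a tie
   requires the last resolution step. *)
have [e|ne] := eqVneq (hts l) (hts r); last first.
  rewrite /= (negbTE ne) geq_max.
  by rewrite (child true (v, true) _ _ _ _ _ R) ?(child false (v, false) _ _ _ _ _ R).
have hT' b : hts (T' b) = hts l by case: b.
have side x : exists2 b, x.1 = v -> x.2 = b & x.1 \notin labels (T' b).
  have [->|xv] := eqVneq x.1 v; first by exists x.2.
  have [xl|xl] := boolP (x.1 \in labels l).
    by exists false => [e'|]; [rewrite e' eqxx in xv | apply: lr].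
  by exists true => // e'; rewrite e' eqxx in xv.
have [/imfsetP[[|b w] wT]|] := refutation_inv R erefl.
- by have := lvs_nil v l r; rewrite [_ \in _]wT.
- by move=> /esym/fsetP/(_ (v, b)); rewrite !inE eqxx.
case=> x [C1 [C2 [t1 [t2 [-> s1 s2 R1 R2]]]]].
have -> : hts (Node v l r) = (hts l).+1 by rewrite /= e eqxx.
apply: hts_NodeS.
  by have [b xb nb] := side x; rewrite -(hT' b); apply: child s1 _ _ R1.
by have [b xb nb] := side (compl x); rewrite -(hT' b); apply: child s2 _ _ R2.
Qed.
End Resolution.

(** * The doped clauses of a tree *)

Section Doping.
Set Implicit Arguments.
Unset Strict Implicit.
Variables (VA : choiceType) (T : tree VA) (u : clause VA -> VA).
Implicit Types (x y : literal VA) (C E : clause VA) (F G : clause_set VA)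
  (w : position) (V W : {fset position}) (phi psi : passign VA).

Local Notation F := (leaf_clauses T).
Local Notation D w := (dope_clause u (path_clause T w)).
Local Notation uw w := (u (path_clause T w)).
Local Notation DV V := [fset D w | w in V].

Hypothesis uniqT : uniq (labels T).
Hypothesis dopingF : doping_vars F u.

Lemma lvs_neq0 (T' : tree VA) : lvs T' <> fset0.
Proof.
elim: T' => [|v l IHl r _].
  by move/fsetP/(_ [::]); rewrite !inE.
have /eqP/fset0Pn[w wl] := IHl.
by move=> /fsetP/(_ (true :: w)); rewrite lvs_cons wl.
Qed.

Lemma mem_leaf_clauses w : w \in lvs T -> path_clause T w \in F.
Proof. by move=> wT; apply/imfsetP; exists w. Qed.

Lemma var_path w x : w \in lvs T -> x \in path_clause T w -> x.1 \in var F.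
Proof.
move=> wT xw; apply/bigfcupP; exists (path_clause T w).
  by rewrite mem_leaf_clauses.
by apply/imfsetP; exists x.
Qed.

Lemma u_fresh w : w \in lvs T -> uw w \notin var F.
Proof. by move=> wT; apply: dopingF.2; apply: mem_leaf_clauses. Qed.

Lemma u_notin_path w w' b : w \in lvs T -> w' \in lvs T ->
  ((uw w, b) \in path_clause T w') = false.
Proof.
move=> wT w'T; apply/negP => /(var_path w'T) /=; apply/negP; exact: u_fresh.
Qed.

Lemma path_clause_inj : {in lvs T &, injective (path_clause T)}.
Proof.
move=> w w' wT w'T e; apply/eqP/negPn/negP => /(leaves_clash wT w'T)[x xw].
by rewrite -e; apply/negP/(is_clauseP _ (path_is_clause w uniqT)).
Qed.

Lemma u_inj w w' : w \in lvs T -> w' \in lvs T -> uw w = uw w' -> w = w'.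
Proof.
move=> wT w'T /dopingF.1 e; apply: path_clause_inj => //.
by apply: e; apply: mem_leaf_clauses.
Qed.

Lemma dopeE : dope u F = DV (lvs T).
Proof.
apply/fsetP => C; apply/imfsetP/imfsetP => /= [[_ /imfsetP[w /= wT ->] ->]|].
  by exists w.
by case=> w wT ->; exists (path_clause T w) => //; apply: mem_leaf_clauses.
Qed.

Lemma mem_D w x : (x \in D w) = (x == (uw w, true)) || (x \in path_clause T w).
Proof. by rewrite !inE. Qed.

Lemma D_is_clause w : w \in lvs T -> is_clause (D w).
Proof.
move=> wT; apply/is_clauseP => x; rewrite !mem_D negb_or.
case/orP=> [/eqP->|xw].
  by rewrite compl_neq /compl /= u_notin_path.
rewrite (is_clauseP _ (path_is_clause w uniqT) _ xw) andbT.
by apply/eqP => e; rewrite -[x]complK e u_notin_path in xw.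
Qed.

Lemma D_clash w w' : w \in lvs T -> w' \in lvs T -> w != w' ->
  exists2 x, x \in D w & compl x \in D w'.
Proof.
move=> wT w'T /(leaves_clash wT w'T)[x xw xw'].
by exists x; rewrite mem_D ?xw ?xw' orbT.
Qed.

(** Distinct doped clauses clash, so they cannot share a superset without complementary pair. This
    makes every choice of superclauses in (1) injective. *)
Lemma D_sub_inj C w w' : is_clause C -> w \in lvs T -> w' \in lvs T ->
  D w `<=` C -> D w' `<=` C -> w = w'.
Proof.
move=> /is_clauseP clC wT w'T /fsubsetP wC /fsubsetP w'C.
apply/eqP/negPn/negP => /(D_clash wT w'T)[x /wC xC /w'C].
by apply/negP/clC.
Qed.

(** * The clauses [C_of T u V] as the prime implicates *)

Lemma mem_lits_DV V x :
  reflect (exists2 w, w \in V & x \in D w) (x \in lits (DV V)).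
Proof.
apply: (iffP (litsP _ _)) => [[_ /imfsetP[w /= wV ->] xw]|[w wV xw]].
  by exists w.
by exists (D w) => //; apply/imfsetP; exists w.
Qed.

(** A doping variable occurs in one doped clause only, and there positively, so it is always pure.
    Hence [V] can be recovered from its clause. *)
Lemma C_of_u V w : V `<=` lvs T -> w \in lvs T ->
  ((uw w, true) \in C_of T u V) = (w \in V).
Proof.
move=> /fsubsetP VT wT; rewrite pureE.
apply/andP/idP => [[/mem_lits_DV[w' wV']]|wV].
  rewrite mem_D u_notin_path // ?VT // orbF => /eqP[/u_inj e] _.
  by rewrite (e wT (VT _ wV')).
split; first by apply/mem_lits_DV; exists w; rewrite // mem_D eqxx.
apply/mem_lits_DV => -[w' wV'].
by rewrite mem_D /compl /= u_notin_path // ?VT // xpair_eqE andbF.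
Qed.

Lemma C_of_path V w x : V `<=` lvs T -> w \in V -> x \in path_clause T w ->
  (x \in C_of T u V) = [forall w' : V, compl x \notin path_clause T (val w')].
Proof.
move=> /fsubsetP VT wV xw; rewrite pureE.
have -> : x \in lits (DV V) by apply/mem_lits_DV; exists w; rewrite // mem_D xw orbT.
apply/idP/forallP => /= [nx w'|h].
  apply: contraNN nx => xw'; apply/mem_lits_DV; exists (val w') => //.
    exact: valP.
  by rewrite mem_D xw' orbT.
apply/mem_lits_DV => -[w' w'V]; rewrite mem_D (negbTE (h [` w'V])) orbF.
move/eqP => e; have : x.1 \in var F by apply: var_path xw; apply: VT.
by rewrite (congr1 fst e : x.1 = _); apply/negP/u_fresh/VT.
Qed.

Lemma implies_C_of V : V `<=` lvs T -> V <> fset0 ->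
  implies (DV V) (C_of T u V).
Proof.
move=> VT /eqP/fset0Pn[w0 w0V]; apply/impliesP => phi sat.
have VT' := fsubsetP VT.
have [|w [wT wV Hw]] := @descent _ T phi (fun w => w \in V) uniqT.
  by exists w0; rewrite ?VT'.
have /hasP[y] : has (lit_true phi) (D w) by apply: sat; apply/imfsetP; exists w.
rewrite mem_D => /orP[/eqP->|yw] py; apply/hasP.
  by exists (uw w, true); rewrite // C_of_u.
exists y => //; rewrite (C_of_path VT wV yw); apply/forallP => -[w' w'V] /=.
exact: Hw (VT' _ w'V) w'V.
Qed.

(* Falsify [C_V] and the path to [w]: all other paths contain a literal
   complementary to one on the path to [w]. *)
Lemma C_of_critical V w : V `<=` lvs T -> w \in V -> exists phi,
  (forall w', w' \in lvs T -> w' != w -> has (lit_true phi) (D w')) /\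
  ~~ has (lit_true phi) (C_of T u V).
Proof.
move=> VT wV; have wT := fsubsetP VT _ wV.
have nC x : x \in C_of T u V -> compl x \notin path_clause T w.
  rewrite pureE => /andP[_]; apply: contraNN => xw; apply/mem_lits_DV.
  by exists w; rewrite // mem_D xw orbT.
have clN : is_clause (C_of T u V `|` path_clause T w).
  apply/is_clauseP => x; rewrite !in_fsetU negb_or => /orP[xC|xw].
    by rewrite nC // (is_clauseP _ (pure_is_clause _) _ xC).
  rewrite (is_clauseP _ (path_is_clause w uniqT) _ xw) andbT.
  by apply: contraTN xw => /nC; rewrite complK.
exists (falsifier (C_of T u V `|` path_clause T w)); split; last first.
  by apply: falsifier_unsat => //; apply: fsubsetUl.
move=> w' w'T /(leaves_clash w'T wT)[x xw' xw]; apply/hasP; exists x.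
  by rewrite mem_D xw' orbT.
by rewrite falsifierE // in_fsetU xw orbT.
Qed.

Lemma C_of_mps V : V `<=` lvs T -> V <> fset0 ->
  minimal_premise_set (DV V) (C_of T u V).
Proof.
move=> VT V0; split; first exact: implies_C_of.
move=> G /andP[/fsubsetP GV /fsubsetPn[_ /imfsetP[w /= wV ->] nG]] /impliesP GC.
have [phi [sat /negP]] := C_of_critical VT wV; apply; apply: GC => E EG.
have /imfsetP[w' /= w'V e] := GV _ EG; subst E.
apply: sat; first exact: (fsubsetP VT).
by apply: contraNneq nG => <-.
Qed.

Lemma sub_dope G : G `<=` dope u F -> exists2 V, V `<=` lvs T & G = DV V.
Proof.
rewrite dopeE => /fsubsetP GD; exists [fset w in lvs T | D w \in G].
  by apply/fsubsetP => w; rewrite !inE => /andP[].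
apply/fsetP => C; apply/idP/imfsetP => /= [CG|[w]]; last first.
  by rewrite !inE => /andP[_ ?] ->.
have /imfsetP[w /= wT e] := GD _ CG; exists w => //.
by rewrite !inE wT -e.
Qed.

Lemma DV_sub V : V `<=` lvs T -> DV V `<=` dope u F.
Proof.
move=> /fsubsetP VT; rewrite dopeE; apply/fsubsetP => _ /imfsetP[w /= wV ->].
by apply/imfsetP; exists w => //; apply: VT.
Qed.

Lemma total_mps_dope : total_mps (dope u F).
Proof.
split=> [|G /sub_dope[V VT ->] V0].
  have /eqP/fset0Pn[w wT] := @lvs_neq0 T.
  by rewrite dopeE => /fsetP/(_ (D w)); rewrite in_fset0 => /imfsetP; case; exists w.
exists (C_of T u V); split; first exact: pure_is_clause.
by apply: C_of_mps => // e; apply: V0; rewrite e; apply/fsetP => C;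
  rewrite in_fset0; apply/imfsetP => -[].
Qed.

(** A minimal premise set of [C] inside the doped clauses has the form [DV V], and its pure literals
    lie in [C]. [V] is nonempty because [falsifier C] satisfies the empty premise set. *)
Lemma implicate_dope C : is_clause C -> implies (dope u F) C ->
  exists V, [/\ V `<=` lvs T, V <> fset0 & C_of T u V `<=` C].
Proof.
move=> clC /mps_exists[_ /sub_dope[V VT ->] mps]; exists V; split=> //.
  move=> V0; case: mps => /impliesP/(_ (falsifier C)) h _.
  have /negP := falsifier_unsat clC (fsubset_refl C); apply; apply: h => E.
  by rewrite V0 => /imfsetP[].
exact: pure_sub_mps.
Qed.

(** A smaller implicate contains the clause of some [W], and comparing doping literals gives that
    [W] is a subset of [V]. It is proper, so a proper part of [DV V] would imply the clause of [V],
    against [C_of_mps]. *)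
Lemma C_of_prc0 V : V `<=` lvs T -> V <> fset0 -> prc0 (dope u F) (C_of T u V).
Proof.
move=> VT V0; split; first exact: pure_is_clause.
  by apply: implies_mono (implies_C_of VT V0); apply: DV_sub.
move=> E clE EV /(implicate_dope clE)[W [WT W0 WE]].
have WV : C_of T u W `<` C_of T u V by apply: fsub_proper_trans EV.
have sWV : W `<=` V.
  apply/fsubsetP => w wW; have wT := fsubsetP WT _ wW.
  by rewrite -C_of_u // (fsubsetP (fproper_sub WV)) // C_of_u.
have /eqVfproper[e|lt] : DV W `<=` DV V.
  apply/fsubsetP => _ /imfsetP[w /= wW ->]; apply/imfsetP; exists w => //.
    exact: (fsubsetP sWV).
  by move: WV; rewrite /C_of e (negbTE (fproper_irrefl _)).
have [_ /(_ _ lt)] := C_of_mps VT V0; apply.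
by apply: implies_weaken (implies_C_of WT W0); apply: fproper_sub.
Qed.

Lemma prc0_dope C : prc0 (dope u F) C <->
  exists V, [/\ V <> fset0, V `<=` lvs T & C = C_of T u V].
Proof.
split=> [[clC FC mC]|[V [V0 VT ->]]]; last exact: C_of_prc0.
have [V [VT V0 /eqVfproper[e|lt]]] := implicate_dope clC FC; first by exists V.
case: (mC _ (pure_is_clause _) lt).
by have [] := C_of_prc0 VT V0.
Qed.

(** * Splitting into doping literals and tree literals; clause-sets equivalent to the doped one *)

Lemma mem_P_of V x : (x \in P_of F T V) =
  [&& x.1 \in var F, V `&` lvs_sub T x != fset0
    & V `&` lvs_sub T (compl x) == fset0].
Proof.
have -> : (x.1 \in var F) = (x \in lits_over F).
  by rewrite in_fsetM !inE; case: (x.2); rewrite andbT.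
by rewrite in_fset inE.
Qed.

Lemma C_of_U_P V : V `<=` lvs T -> C_of T u V = U_of T u V `|` P_of F T V.
Proof.
move=> VT; have VT' := fsubsetP VT; apply/fsetP => x; rewrite in_fsetU.
have sub y w : w \in V -> (w \in lvs_sub T y) = (y \in path_clause T w).
  by move=> /VT'; apply: mem_lvs_sub.
apply/idP/orP => [xC|[/imfsetP[w /= wV ->]|]]; last 2 first.
- by rewrite C_of_u ?VT'.
- rewrite mem_P_of => /and3P[_ /fset0Pn[w]].
  rewrite in_fsetI => /andP[wV]; rewrite sub // => xw /eqP/fsetP h.
  rewrite (C_of_path VT wV xw); apply/forallP => -[w' w'V] /=.
  by have := h w'; rewrite in_fset0 in_fsetI w'V sub //= => ->.
have : x \in C_of T u V := xC; rewrite pureE => /andP[/mem_lits_DV[w wV]].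
rewrite mem_D => /orP[/eqP-> _|xw _]; first by left; apply/imfsetP; exists w.
right; rewrite mem_P_of; apply/and3P; split.
- exact: var_path (VT' _ wV) xw.
- by apply/fset0Pn; exists w; rewrite in_fsetI wV sub.
apply/eqP/fsetP => w'; rewrite in_fset0 in_fsetI; apply/negP => /andP[w'V].
rewrite sub //; apply/negP; move: xC.
by rewrite (C_of_path VT wV xw) => /forallP/(_ [` w'V]).
Qed.

Lemma U_P_disjoint V : V `<=` lvs T -> U_of T u V `&` P_of F T V = fset0.
Proof.
move=> /fsubsetP VT; apply/fsetP => x; rewrite in_fset0 in_fsetI.
apply/negP => /andP[/imfsetP[w /= wV ->]].
by rewrite mem_P_of (negbTE (u_fresh (VT _ wV))).
Qed.

(* Falsify [D w] and satisfy all other doping variables: the clause of [F']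
   that this assignment falsifies contains some [C_V] with [V = {w}]. *)
Lemma equivalent_superset F' w : is_clause_set F' -> equivalent F' (dope u F) ->
  w \in lvs T -> exists2 C, C \in F' & D w `<=` C.
Proof.
move=> /allP clF' eqF' wT.
have w1T : [fset w] `<=` lvs T by rewrite fsub1set.
(* A single clause has no complementary pair, so all of its literals are pure. *)
have C1 : C_of T u [fset w] = D w.
  apply/fsetP => x; rewrite pureE; have L y : (y \in lits (DV [fset w])) = (y \in D w).
    apply/mem_lits_DV/idP => [[w']|yw]; first by rewrite in_fset1 => /eqP->.
    by exists w; rewrite ?in_fset1.
  rewrite !L; case: (boolP (x \in D w)) => //= /(is_clauseP _ (D_is_clause wT)).
  by [].
have w0 : [fset w] <> fset0 by move/fsetP/(_ w); rewrite !inE eqxx.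
have [_ /impliesP F'D _] : prc0 F' (D w).
  by apply/eqF'; rewrite -C1; apply: C_of_prc0.
pose N := D w `|` [fset (uw w', false) | w' in lvs T `\ w].
have clN : is_clause N.
  have mN y : (y \in N) = (y \in D w)
      || (y \in [fset (uw w', false) | w' in lvs T `\ w]) by rewrite in_fsetU.
  apply/is_clauseP => x; rewrite !mN negb_or => /orP[xD|].
    rewrite (is_clauseP _ (D_is_clause wT) _ xD); apply/imfsetP => -[w' /=].
    rewrite !inE => /andP[nw w'T] e; move: xD; rewrite -[x]complK e /compl /=.
    rewrite mem_D u_notin_path // orbF => /eqP[/(u_inj w'T wT)] e'.
    by rewrite e' eqxx in nw.
  case/imfsetP=> w' /=; rewrite !inE => /andP[nw w'T] ->.
  rewrite /compl /= u_notin_path // orbF; apply/andP; split.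
    by apply: contra nw => /eqP[/(u_inj w'T wT) ->].
  by apply/imfsetP => -[w'' _ []].
have /allPn[C CF' nC] : ~~ all (fun C : clause VA => has (lit_true (falsifier N)) C) F'.
  apply/negP => /allP/F'D; apply/negP.
  by apply: falsifier_unsat => //; apply: fsubsetUl.
(* [C] is an implicate of [F'], so it contains a prime implicate of [F'], which equivalence
   transfers to the doped clause-set. *)
have [|E EC /eqF'/prc0_dope[V [V0 VT e]]] := @prc0_below _ F' C (clF' _ CF').
  by apply/impliesP => phi; apply.
exists C => //; apply: fsubset_trans (EC); rewrite e -C1.
have -> : V = [fset w]; last by [].
have VT' := fsubsetP VT.
(* The doping literal of any other leaf is true under [falsifier N], but [C] is not satisfied by
   it. *)
have Vw w' : w' \in V -> w' = w.
  move=> w'V; apply/eqP/negPn/negP => nw; case/hasP: nC.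
  exists (uw w', true); first by rewrite (fsubsetP EC) // e C_of_u ?VT'.
  rewrite falsifierE // in_fsetU; apply/orP; right; apply/imfsetP.
  by exists w'; rewrite //= !inE nw VT'.
have /eqP/fset0Pn[w' w'V] := V0.
apply/fsetP => z; rewrite in_fset1; apply/idP/eqP => [/Vw //|->].
by rewrite -(Vw _ w'V).
Qed.

Lemma equivalent_injection F' : is_clause_set F' -> equivalent F' (dope u F) ->
  exists i : clause VA -> clause VA,
    [/\ {in dope u F, forall C, i C \in F'},
        {in dope u F &, injective i}
      & {in dope u F, forall C, C `<=` i C}].
Proof.
(* [i C] is the first clause of [F'] containing [C]; on doped clauses the default [fset0] is never
   reached. *)
move=> clF' eqF'; pose i C := nth fset0 F' (find (fsubset C) F').
have iP w : w \in lvs T -> (i (D w) \in F') && (D w `<=` i (D w)).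
  move=> wT; have [C CF' wC] := equivalent_superset clF' eqF' wT.
  have hC : has (fsubset (D w)) F' by apply/hasP; exists C.
  by rewrite /i nth_find // mem_nth // -has_find.
exists i; rewrite dopeE; split.
- by move=> _ /imfsetP[w /= /iP/andP[? _] ->].
- move=> _ _ /imfsetP[w /= wT ->] /imfsetP[w' /= w'T ->] e.
  have /andP[iF' sw] := iP _ wT; have /andP[_ sw'] := iP _ w'T.
  by rewrite -e in sw'; rewrite (D_sub_inj (allP clF' _ iF') wT w'T sw sw').
- by move=> _ /imfsetP[w /= /iP/andP[_ ?] ->].
Qed.

(** * Hardness of the doped clause-set *)

Lemma dope_satisfiable : satisfiable (dope u F).
Proof.
pose N : clause VA := [fset (uw w, false) | w in lvs T].
have clN : is_clause N.
  by apply/is_clauseP => _ /imfsetP[w _ ->]; apply/imfsetP => -[w' _ []].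
exists (falsifier N); apply/eqP/satP; rewrite dopeE => _ /imfsetP[w /= wT ->].
apply/hasP; exists (uw w, true); first by rewrite mem_D eqxx.
by rewrite falsifierE //; apply/imfsetP; exists w.
Qed.

Lemma dope_neq0 : dope u F <> fset0.
Proof. by have [] := total_mps_dope. Qed.

(** Setting all doping variables to false satisfies no doped clause and deletes exactly the doping
    literals. *)
Lemma undope : exists phi, papply phi (dope u F) = F.
Proof.
pose N : clause VA := [fset (uw w, true) | w in lvs T].
have clN : is_clause N.
  by apply/is_clauseP => _ /imfsetP[w _ ->]; apply/imfsetP => -[w' _ []].
have NF w x : w \in lvs T -> x \in path_clause T w -> x \notin N.
  move=> wT xw; apply/imfsetP => -[w' /= w'T e]; move: xw.
  by rewrite e u_notin_path.
have nsat w : w \in lvs T -> ~~ has (lit_true (falsifier N)) (D w).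
  move=> wT; apply/hasPn => x; rewrite mem_D falsifierE // => /orP[/eqP->|xw].
    by apply/imfsetP => -[w' _ []].
  apply/imfsetP => -[w' /= w'T e]; move: xw.
  by rewrite -[x]complK e /compl /= u_notin_path.
have red w : w \in lvs T -> papply_clause (falsifier N) (D w) = path_clause T w.
  move=> wT; apply/fsetP => x.
  rewrite mem_papply_clause mem_D lit_falseE falsifierE // complK.
  case: eqP => [->|_] /=.
    rewrite u_notin_path //; apply/negbF.
    by apply/imfsetP; exists w.
  by have [/(NF _ _ wT)|] := boolP (x \in _).
exists (falsifier N); apply/fsetP => C; apply/papplyP/imfsetP.
  case=> E [EF _ ->]; move: EF; rewrite dopeE => /imfsetP[w /= wT ->].
  by exists w => //; apply: red.
case=> w /= wT ->; exists (D w); rewrite nsat // red //; split=> //.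
by rewrite dopeE; apply/imfsetP; exists w.
Qed.

(* A leaf whose path [phi] does not satisfy but whose doping variable [phi]
   leaves free or satisfies yields an assignment satisfying the restriction. *)
Lemma papply_sub_dope phi : ~ satisfiable (papply phi (dope u F)) ->
  papply phi F `<=` papply phi (dope u F).
Proof.
move=> unsat; apply/fsubsetP => _ /papplyP[_ [/imfsetP[w /= wT ->] nw ->]].
have [uf|nuf] := boolP (lit_false phi (uw w, true)).
  apply/papplyP; exists (D w); split.
  - by rewrite dopeE; apply/imfsetP; exists w.
  - apply/hasPn => x; rewrite mem_D => /orP[/eqP->|xw]; last exact: (hasPn nw).
    by have := lit_true_compl (uf : lit_true phi (compl (uw w, true))).
  apply/fsetP => x; rewrite !mem_papply_clause mem_D.
  by case: eqP => [->|//]; rewrite uf !andbF.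
case: unsat; pose N := (uw w, false) |` path_clause T w.
have clN : is_clause N.
  apply/is_clauseP => x; rewrite !in_fset1U negb_or => /orP[/eqP->|xw].
    by rewrite compl_neq /compl /= u_notin_path.
  rewrite (is_clauseP _ (path_is_clause w uniqT) _ xw) andbT.
  by apply/eqP => e; rewrite -[x]complK e u_notin_path in xw.
exists (falsifier N); apply/eqP/satP => _ /papplyP[E [ED nE ->]].
move: ED nE; rewrite dopeE => /imfsetP[w' /= w'T ->] _; apply/hasP.
have [->|ne] := eqVneq w' w.
  exists (uw w, true); first by rewrite mem_papply_clause mem_D eqxx nuf.
  by rewrite falsifierE // in_fset1U eqxx.
have [x xw' xw] := leaves_clash w'T wT ne; exists x.
  by rewrite mem_papply_clause mem_D xw' orbT lit_falseE (hasPn nw).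
by rewrite falsifierE // in_fset1U xw orbT.
Qed.

Lemma resolution_leaf_clauses : resolution F fset0 T.
Proof.
apply: resolution_tree => // w wT; rewrite fset0U; exact: mem_leaf_clauses.
Qed.

(** The value is attained at the restriction that gives back [F], for which [T] is an optimal
    refutation. Any unsatisfiable restriction contains the same restriction of [F], and restricting
    [T] refutes that. *)
Lemma hd_dope : ~ satisfiable F -> hd (dope u F) (hts T).
Proof.
move=> unsatF; apply: Or33; split.
- exact: dope_satisfiable.
- exact: dope_neq0.
- have [phi e] := undope; exists phi; rewrite e; split=> //; split=> [|t].
    by exists T => //; apply: resolution_leaf_clauses.
  exact: hts_refutation.
move=> phi k /papply_sub_dope sub [_ low].
have [//|C [t [sC R h]]] :=
  resolution_restrict (psi := phi) resolution_leaf_clauses.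
apply: leq_trans (low t _) h; apply: resolution_mono sub _.
suff -> : fset0 = C by [].
apply/esym/eqP; rewrite -fsubset0; apply: fsubset_trans sC _.
by apply/fsubsetP => x; rewrite mem_papply_clause.
Qed.

End Doping.

Theorem theorem5p22 (VA : choiceType) (F : clause_set VA) (T : tree VA)
    (u : clause VA -> VA) :
  SMU1 F -> tree_representation T F -> doping_vars F u ->
  [/\ (forall F' : clause_set VA, is_clause_set F' ->
         equivalent F' (dope u F) ->
         exists i : clause VA -> clause VA,
           [/\ {in dope u F, forall C, i C \in F'},
               {in dope u F &, injective i}
             & {in dope u F, forall C, C `<=` i C}]),
      total_mps (dope u F),
      (forall C : clause VA,
         prc0 (dope u F) C <->
         exists V : {fset position},
           [/\ V <> fset0, V `<=` lvs T & C = C_of T u V]) /\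
      (forall V : {fset position}, V <> fset0 -> V `<=` lvs T ->
         C_of T u V = U_of T u V `|` P_of F T V /\
         U_of T u V `&` P_of F T V = fset0)
    & hd (dope u F) (hts T)].
Proof.
move=> [_ [unsatF _] _ _] [uniqT eF] dopingF; subst F.
split.
- exact: equivalent_injection.
- exact: total_mps_dope.
- split; first exact: prc0_dope.
  by move=> V _ VT; split; [apply: C_of_U_P | apply: U_P_disjoint].
- exact: hd_dope.
Qed.
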